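(* There exist $d,n\ge1$ and $A_0,A_1,\dots,A_n\in\mathbb{C}^{d\times d}_{\mathrm{herm}}$ such that the function $F:\{Z\in\mathbb{C}^{d\times d}_{\mathrm{herm}}: Z\succ0\}\to\mathbb{R}$ defined by $$F(Z)=\lambda_{\max}\Big(Z+A_0+\sum_{i=1}^n\tfrac12 Z^{1/2}\big((I_d+4(Z^{-1/2}A_iZ^{-1/2})^2)^{1/2}-I_d\big)Z^{1/2}\Big)$$ is not convex. Moreover, these matrices may be chosen to satisfy $A_i\succ 0$ for all $i=0,1,\dots,n$.
   Context: $\mathbb{C}^{d\times d}_{\mathrm{herm}}$ is the set of $d\times d$ complex Hermitian matrices; $\succ$ is the strict Loewner order (positive definiteness); $\lambda_{\max}$ is the largest eigenvalue; square roots are the positive semidefinite square roots. *)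

(* Defs.v *)
From HB Require Import structures.
From mathcomp Require Import all_boot all_order all_algebra.
From mathcomp Require Import boolp classical_sets reals.
From mathcomp Require Import complex.

Set Implicit Arguments.
Unset Strict Implicit.
Unset Printing Implicit Defensive.

Import Order.TTheory GRing.Theory Num.Theory.
Local Open Scope ring_scope.
Local Open Scope classical_set_scope.
Local Open Scope sesquilinear_scope.

Section LoewnerOrder.
Variables (R : realType) (d : nat).
Implicit Types A : 'M[R[i]]_d.

(* The order on R[i] is the partial one: [0 <= z] means that z is real and
   nonnegative. The row vector u plays the role of the conjugate transpose of
   the usual column vector. *)
Definition posdefmx A : Prop :=
  A \is hermsymmx /\
  forall u : 'rV[R[i]]_d, u != 0 -> 0 < (u *m A *m u^t*) ord0 ord0.

Definition possemidefmx A : Prop :=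
  A \is hermsymmx /\
  forall u : 'rV[R[i]]_d, 0 <= (u *m A *m u^t*) ord0 ord0.

(* The positive semidefinite square root of A; it exists and is unique when
   A is positive semidefinite, and the value is the junk 0 if there is none. *)
Definition sqrtmx A : 'M[R[i]]_d :=
  xget 0 [set S | possemidefmx S /\ S *m S = A].

(* For A Hermitian and d > 0 the set is finite and nonempty, so the supremum
   is a maximum. *)
Definition lambda_max A : R := sup [set x : R | eigenvalue A (x%:C)%C].

End LoewnerOrder.

Section ConvexOn.
Variables (R : realType) (d : nat).

(* Convexity is with respect to the real vector space structure; the library's
   [convex_function] needs a module over R, whereas 'M[R[i]]_d is canonically
   one over R[i] only. *)
Definition convex_on (D : set 'M[R[i]]_d) (f : 'M[R[i]]_d -> R) : Prop :=
  forall X Y, D X -> D Y -> forall t : R, 0 <= t <= 1 ->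
    f ((t%:C)%C *: X + ((1 - t)%:C)%C *: Y) <= t * f X + (1 - t) * f Y.

End ConvexOn.

(* Z^{1/2} ((I + 4 (Z^{-1/2} A Z^{-1/2})^2)^{1/2} - I) Z^{1/2} / 2 *)
Definition summand (R : realType) (d : nat) (A Z : 'M[R[i]]_d) : 'M[R[i]]_d :=
  let P := sqrtmx Z in
  let B := invmx P *m A *m invmx P in
  2^-1 *: (P *m (sqrtmx (1%:M + 4 *: (B *m B)) - 1%:M) *m P).

(* The n + 1 matrices A_0, A_1, ..., A_n are [A ord0] and, for i < n,
   [A (lift ord0 i)]. *)
Definition Ffun (R : realType) (d n : nat) (A : 'I_n.+1 -> 'M[R[i]]_d)
    (Z : 'M[R[i]]_d) : R :=
  lambda_max (Z + A ord0 + \sum_(i < n) summand (A (lift ord0 i)) Z).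

(* Main.v *)
Require Import Defs.
From HB Require Import structures.
From mathcomp Require Import all_boot all_order all_algebra.
From mathcomp Require Import boolp classical_sets reals.
From mathcomp Require Import complex.
From mathcomp Require Import ring lra.

(** Take n = 1 and A_1 = k I. Then everything commutes with Z and the summand
    is (S - Z) / 2 with S = (Z^2 + 4 k^2 I)^{1/2}, so that
    F(Z) = lambda_max (A_0 + (Z + S) / 2) ([summand_scalar]). Now the scalar
    function z |-> (z^2 + 4 k^2)^{1/2} is convex but not operator convex: for
    small Z its expansion is 2k + Z^2 / (4k) - Z^4 / (64 k^3) + ..., and along
    the line Z_t = [[p, s], [s, t]] the corner entry of Z_t^2, which is
    p^2 + s^2, is constant, whereas that of Z_t^4, which is
    (p^2 + s^2)^2 + s^2 (p + t)^2, is strictly convex. So the corner entry of S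
    is strictly concave in t for suitable p, s and k. Finally
    A_0 = diag(e, 1) with e large makes lambda_max follow the corner entry up
    to an error O(1/e), and F itself is not convex along the line.

    The explicit choice is k = 2, p = 2, s = 1, e = 40: with t = 1, 2, 3 the
    values of F are about 43.29627, 43.29404 and 43.29161, and the middle one
    exceeds the mean 43.29394 of the other two.

    To evaluate F, [posdefmx_sqr_inj] identifies the square roots
    (a positive definite S is the only positive semidefinite root of S^2), and
    for 2 x 2 matrices the root and the top eigenvalue have closed forms
    ([rootmx_sqr], [lambda_max_symmx]): the root of M is
    (M + delta I) / (tr M + 2 delta)^{1/2} with delta = (det M)^{1/2}. *)

Set Implicit Arguments.
Unset Strict Implicit.
Unset Printing Implicit Defensive.

Import Order.TTheory GRing.Theory Num.Theory.
Local Open Scope ring_scope.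
Local Open Scope classical_set_scope.
Local Open Scope sesquilinear_scope.
Local Open Scope complex_scope.

(** * Positive definite matrices and their square roots *)

Section PositiveDefinite.
Variables (R : realType) (d : nat).
Implicit Types A B P S T Z : 'M[R[i]]_d.

Lemma posdefmx_possemidef A : posdefmx A -> possemidefmx A.
Proof.
move=> [hA pA]; split=> // u; have [->|u0] := eqVneq u 0.
  by rewrite !mul0mx mxE.
exact: ltW (pA u u0).
Qed.

Lemma posdefmx_unit A : posdefmx A -> A \in unitmx.
Proof.
move=> [_ pA]; rewrite -row_free_unit -kermx_eq0; apply/negPn/negP => /rowV0Pn.
case=> u /sub_kermxP uA /pA; by rewrite uA mul0mx mxE ltxx.
Qed.

Lemma hermsymmx_trmxC A : A \is hermsymmx -> A = A ^t*.
Proof. by move/is_hermitianmxP; rewrite expr0 scale1r. Qed.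

Lemma trmxC_hermsymmx A : A = A ^t* -> A \is hermsymmx.
Proof. by move=> ?; apply/is_hermitianmxP; rewrite expr0 scale1r. Qed.

Lemma trmxC_mulmx m n p (A : 'M[R[i]]_(m, n)) (B : 'M[R[i]]_(n, p)) :
  (A *m B) ^t* = B ^t* *m A ^t*.
Proof. by rewrite trmx_mul map_mxM. Qed.

Lemma posdefmx_congr P S :
  P \is hermsymmx -> P \in unitmx -> posdefmx S -> posdefmx (P *m S *m P).
Proof.
move=> /hermsymmx_trmxC hP uP [/hermsymmx_trmxC hS pS]; split.
  by apply: trmxC_hermsymmx; rewrite !trmxC_mulmx -hP -hS mulmxA.
move=> u u0; have -> : u *m (P *m S *m P) *m u ^t* = u *m P *m S *m (u *m P) ^t*.
  by rewrite trmxC_mulmx -hP !mulmxA.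
by apply: pS; apply: contraNneq u0 => uP0; rewrite -(mulmxK uP u) uP0 mul0mx.
Qed.

Lemma invmx_posdef_herm P : posdefmx P -> invmx P \is hermsymmx.
Proof.
move=> pP; have uP := posdefmx_unit pP; have hP := hermsymmx_trmxC pP.1.
apply: trmxC_hermsymmx.
have e : P *m (invmx P) ^t* = 1%:M.
  by rewrite {1}hP -trmxC_mulmx mulVmx // trmx1 map_mx1.
by rewrite -[LHS]mulmx1 -e mulKmx.
Qed.

(** With D = S - T, the equation S^2 = T^2 says that S D = - D T, so that
    tr (D S D) + tr (D T D) = 0. Both traces are sums of values of the forms S
    and T at the rows of D, hence nonnegative, hence zero; and S is definite, so
    the rows of D vanish. *)
Lemma posdefmx_sqr_inj S T :
  posdefmx S -> possemidefmx T -> T *m T = S *m S -> T = S.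
Proof.
move=> pS pT eTS; pose D := S - T.
have hS := hermsymmx_trmxC pS.1; have hT := hermsymmx_trmxC pT.1.
have hD : D = D ^t* by rewrite /D linearB /= map_mxB -hS -hT.
have SD : S *m D = - (D *m T).
  by rewrite mulmxBr mulmxBl eTS opprB.
have tr0 : \tr (D *m S *m D) + \tr (D *m T *m D) = 0.
  by rewrite -mulmxA mxtrace_mulC SD mulNmx linearN addNr.
have entry A i : (D *m A *m D) i i = (row i D *m A *m (row i D) ^t*) ord0 ord0.
  have -> : (row i D) ^t* = col i D.
    by rewrite {2}hD; apply/matrixP=> j k; rewrite !mxE.
  rewrite -row_mul !mxE; apply: eq_bigr => k _.
  by rewrite [in RHS]mxE [col _ _ _ _]mxE.
(* The guard [true] is that of the index predicate of the trace. *)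
have trS_ge0 i : true -> 0 <= (D *m S *m D) i i.
  by rewrite entry => _; exact: (posdefmx_possemidef pS).2.
have trT_ge0 : 0 <= \tr (D *m T *m D).
  by apply: sumr_ge0 => i _; rewrite entry; exact: pT.2.
have /eqP trS0 : \tr (D *m S *m D) == 0.
  rewrite eq_le; apply/andP; split; last exact: sumr_ge0.
  by move/eqP: tr0; rewrite addr_eq0 => /eqP ->; rewrite oppr_le0.
have D0 : D = 0.
  apply/row_matrixP=> i; rewrite row0; apply/eqP/negPn/negP=> /(pS.2).
  rewrite -entry.
  have /eqP := trS0; rewrite psumr_eq0 // => /allP /(_ i (mem_index_enum i)) /eqP ->.
  by rewrite ltxx.
by apply/esym/eqP; rewrite -subr_eq0 -/D D0.
Qed.

Lemma sqrtmx_sqr S : posdefmx S -> sqrtmx (S *m S) = S.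
Proof.
move=> pS; apply: xget_unique; first by split=> //; exact: posdefmx_possemidef.
by move=> T [pT]; apply: posdefmx_sqr_inj.
Qed.

(** With Z = P^2 and A = a I the inner root is that of
    I + 4 a^2 Z^-2 = (Z^2 + 4 a^2 I) Z^-2, and it equals P^-1 S P^-1, which is
    congruent to S and hence positive definite; the outer factors P cancel the
    two P^-1. *)
Lemma summand_scalar (a : R[i]) P S :
    posdefmx P -> posdefmx S -> comm_mx P S ->
    S *m S = P *m P *m (P *m P) + (4 * a ^+ 2)%:M ->
  summand a%:M (P *m P) = 2^-1 *: (S - P *m P).
Proof.
move=> pP pS cPS eS; rewrite /summand sqrtmx_sqr //.
have uP := posdefmx_unit pP; set Q := invmx P.
have pQ : posdefmx (Q *m S *m Q).
  by apply: posdefmx_congr; rewrite ?unitmx_inv //; exact: invmx_posdef_herm.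
have cQS : S *m Q = Q *m S.
  by rewrite -[LHS](mulKmx uP) (mulmxA P) cPS mulmxK.
have -> : 1%:M + 4 *: (Q *m a%:M *m Q *m (Q *m a%:M *m Q)) =
          Q *m S *m Q *m (Q *m S *m Q).
  have QQ : Q *m a%:M *m Q *m (Q *m a%:M *m Q) = a ^+ 2 *: (Q *m Q *m (Q *m Q)).
    by rewrite -(scalemx1 _ a) -!scalemxAr mulmx1 -!scalemxAl -scalemxAr scalerA.
  have -> : Q *m S *m Q *m (Q *m S *m Q) = Q *m Q *m (S *m S) *m (Q *m Q).
    have e1 : Q *m S *m Q = Q *m Q *m S by rewrite -mulmxA cQS mulmxA.
    have e2 : Q *m S *m Q = S *m Q *m Q by rewrite cQS.
    by rewrite {1}e1 e2 !mulmxA.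
  have QQPP : Q *m Q *m (P *m P) = 1%:M by rewrite mulmxA mulmxKV // mulVmx.
  have PPQQ : P *m P *m (Q *m Q) = 1%:M by rewrite mulmxA mulmxK // mulmxV.
  rewrite eS mulmxDr mulmxDl (mulmxA _ (P *m P)) QQPP mul1mx PPQQ QQ.
  by rewrite -(scalemx1 _ (4 * _)) -scalemxAr mulmx1 -scalemxAl scalerA.
rewrite sqrtmx_sqr // mulmxBr mulmxBl mulmx1 !mulmxA mulmxV // mul1mx.
by rewrite mulmxKV.
Qed.

End PositiveDefinite.

(** * Real symmetric matrices of size two *)

Section RealSymmetric2.
Variable R : realType.
Implicit Types a b c p q r v x : R.

Definition symmx a b c : 'M[R[i]]_2 :=
  map_mx (real_complex R)
    (\matrix_(i, j) if i == j then (if i == ord0 then a else c) else b).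

Lemma forall_ord2 (P : 'I_2 -> Prop) : P ord0 -> P ord_max -> forall i, P i.
Proof.
move=> P0 P1 [[|[|//]] lt_i].
  by rewrite (_ : Ordinal _ = ord0) //; exact: val_inj.
by rewrite (_ : Ordinal _ = ord_max) //; exact: val_inj.
Qed.

Lemma sum_ord2 (V : nmodType) (f : 'I_2 -> V) : \sum_i f i = f ord0 + f ord_max.
Proof.
rewrite big_ord_recr big_ord_recr big_ord0 /= add0r.
by congr (f _ + _); apply: val_inj.
Qed.

Lemma symmxD a b c p q r : symmx a b c + symmx p q r = symmx (a + p) (b + q) (c + r).
Proof.
by rewrite -map_mxD; congr map_mx; apply/matrixP=> i j; rewrite !mxE; do !case: ifP.
Qed.

Lemma symmxZ k a b c : k%:C *: symmx a b c = symmx (k * a) (k * b) (k * c).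
Proof.
by rewrite -map_mxZ; congr map_mx; apply/matrixP=> i j; rewrite !mxE; do !case: ifP.
Qed.

Lemma symmx_scalar a : symmx a 0 a = (a%:C)%:M.
Proof.
rewrite -map_scalar_mx; congr map_mx; apply/matrixP=> i j; rewrite !mxE.
by case: eqP; rewrite //= if_same.
Qed.

Lemma symmx_sqr a b c :
  symmx a b c *m symmx a b c = symmx (a ^+ 2 + b ^+ 2) (b * (a + c)) (b ^+ 2 + c ^+ 2).
Proof.
rewrite -map_mxM; congr map_mx; apply/matrixP.
by apply: forall_ord2; apply: forall_ord2; rewrite !mxE sum_ord2 !mxE /=; ring.
Qed.

Lemma posdefmx_symmx a b c : 0 < a -> b ^+ 2 < a * c -> posdefmx (symmx a b c).
Proof.
move=> a0 bac; split.
  apply: trmxC_hermsymmx; rewrite -map_trmx; apply/matrixP=> i j; rewrite !mxE.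
  rewrite (eq_sym j) conj_Creal ?complex_real //.
  by case: eqP => [->|].
move=> u u0.
rewrite mxE sum_ord2 !mxE !sum_ord2 !mxE /=.
have : (u ord0 ord0 != 0) || (u ord0 ord_max != 0).
  apply: contraNT u0; rewrite negb_or !negbK => /andP[/eqP u00 /eqP u01].
  apply/eqP/matrixP=> i j; rewrite ord1 mxE.
  by move: j; apply: forall_ord2.
case: (u ord0 ord0) (u ord0 ord_max) => [x1 x2] [y1 y2].
rewrite !eq_complex ltcE /= => xy0; apply/andP; split.
  by apply/eqP; ring.
(* Completing the square: a times the form is |a x + b y|^2 + (ac - b^2) |y|^2. *)
rewrite -(pmulr_rgt0 _ a0).
have -> : a * ((x1 * a - x2 * 0 + (y1 * b - y2 * 0)) * x1 -
    (x1 * 0 + x2 * a + (y1 * 0 + y2 * b)) * - x2 +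
    ((x1 * b - x2 * 0 + (y1 * c - y2 * 0)) * y1 -
     (x1 * 0 + x2 * b + (y1 * 0 + y2 * c)) * - y2)) =
  (a * x1 + b * y1) ^+ 2 + (a * x2 + b * y2) ^+ 2 +
  (a * c - b ^+ 2) * (y1 ^+ 2 + y2 ^+ 2) by ring.
have sqr_gt0 (z1 z2 : R) : ~~ ((z1 == 0) && (z2 == 0)) -> 0 < z1 ^+ 2 + z2 ^+ 2.
  by move=> z0; rewrite lt0r paddr_eq0 ?addr_ge0 ?sqr_ge0 // !sqrf_eq0 z0.
have [/andP[/eqP y10 /eqP y20]|/sqr_gt0 y0] := boolP ((y1 == 0) && (y2 == 0)).
  move: xy0; rewrite {1}y10 {1}y20 eqxx /= orbF => xy0.
  rewrite (y10 : y1 = 0 :> R) (y20 : y2 = 0 :> R) expr0n /= !mulr0 !addr0.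
  by rewrite mulr0 addr0; apply: sqr_gt0; rewrite !mulf_eq0 (gt_eqF a0).
by rewrite ltr_wpDl ?addr_ge0 ?sqr_ge0 // mulr_gt0 // subr_gt0.
Qed.

Lemma eigenvalue_symmx a b c x :
  eigenvalue (symmx a b c) x%:C = ((x - a) * (x - c) == b ^+ 2).
Proof.
rewrite eigenvalue_map /eigenvalue /eigenspace kermx_eq0 row_free_unit unitmxE unitfE negbK.
rewrite (expand_det_row _ ord0) sum_ord2 /cofactor !det_mx11 !mxE /=.
by rewrite -[LHS]subr_eq0 -[RHS]subr_eq0; congr (_ == 0); ring.
Qed.

(** Among the two roots of the characteristic polynomial (x - a)(x - c) = b^2
    the larger one bounds the spectrum and belongs to it, so it is the
    supremum. *)
Lemma lambda_max_symmx a b c :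
  lambda_max (symmx a b c) = (a + c + Num.sqrt ((a - c) ^+ 2 + 4 * b ^+ 2)) / 2.
Proof.
set D := _ + 4 * _; set l := RHS; rewrite /lambda_max.
have D0 : 0 <= D by rewrite addr_ge0 ?sqr_ge0 // mulr_ge0 ?sqr_ge0.
have ub : ubound [set x | eigenvalue (symmx a b c) x%:C] l.
  move=> x /=; rewrite eigenvalue_symmx => /eqP xb.
  rewrite ler_pdivlMr // -lerBlDl; apply: le_trans (ler_norm _) _.
  rewrite -sqrtr_sqr ler_wsqrtr // le_eqVlt; apply/orP; left; apply/eqP.
  by rewrite /D -xb; ring.
have El : [set x | eigenvalue (symmx a b c) x%:C] l.
  rewrite /= eigenvalue_symmx; apply/eqP.
  have := sqr_sqrtr D0; rewrite /l; set r := Num.sqrt D => r2.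
  have -> : b ^+ 2 = (r ^+ 2 - (a - c) ^+ 2) / 4 by rewrite r2 /D; field.
  by field.
apply/eqP; rewrite eq_le; apply/andP; split.
  by apply: ge_sup => //; exists l.
by apply: ub_le_sup => //; exists l.
Qed.

Lemma lambda_max_symmx_le a b c v :
  a <= v -> c <= v -> b ^+ 2 <= (v - a) * (v - c) -> lambda_max (symmx a b c) <= v.
Proof.
move=> av cv bv; rewrite lambda_max_symmx ler_pdivrMr // -lerBrDl.
rewrite -[leRHS]ger0_norm; last lra.
rewrite -sqrtr_sqr ler_wsqrtr //; lra.
Qed.

Lemma lambda_max_symmx_ge a b c v :
  (v - a) * (v - c) <= b ^+ 2 -> v <= lambda_max (symmx a b c).
Proof.
move=> bv; rewrite lambda_max_symmx ler_pdivlMr // -lerBlDl.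
apply: le_trans (ler_norm _) _.
rewrite -sqrtr_sqr ler_wsqrtr //; lra.
Qed.

(** By Cayley-Hamilton, (M + delta I)^2 = (tr M + 2 delta) M when
    delta^2 = det M; [rootmx] is (M + delta I) / (tr M + 2 delta)^{1/2}. *)
Definition sqrtdet a b c : R := Num.sqrt (a * c - b ^+ 2).
Definition sqrttr a b c : R := Num.sqrt (a + c + 2 * sqrtdet a b c).
Definition rootmx a b c : 'M[R[i]]_2 :=
  symmx ((a + sqrtdet a b c) / sqrttr a b c) (b / sqrttr a b c)
        ((c + sqrtdet a b c) / sqrttr a b c).

Section Root.
Variables a b c : R.
Hypotheses (a_gt0 : 0 < a) (bac : b ^+ 2 < a * c).

Let c_gt0 : 0 < c.
Proof. by rewrite -(pmulr_rgt0 _ a_gt0) (le_lt_trans (sqr_ge0 b)). Qed.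

Let det_gt0 : 0 < a * c - b ^+ 2. Proof. by rewrite subr_gt0. Qed.

Let d := sqrtdet a b c.
Let r := sqrttr a b c.

Lemma sqrtdet_gt0 : 0 < d. Proof. by rewrite sqrtr_gt0. Qed.

Lemma sqrtdet_sqr : d ^+ 2 = a * c - b ^+ 2.
Proof. by rewrite sqr_sqrtr // ltW. Qed.

Let tr_gt0 : 0 < a + c + 2 * d.
Proof. by rewrite !addr_gt0 // mulr_gt0 // sqrtdet_gt0. Qed.

Lemma sqrttr_gt0 : 0 < r. Proof. by rewrite sqrtr_gt0. Qed.

Lemma sqrttr_sqr : r ^+ 2 = a + c + 2 * d.
Proof. by rewrite sqr_sqrtr // ltW. Qed.

Lemma rootmx_posdef : posdefmx (rootmx a b c).
Proof.
have d0 := sqrtdet_gt0; have r0 := sqrttr_gt0.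
apply: posdefmx_symmx; rewrite -/d -/r.
  by rewrite divr_gt0 // addr_gt0.
rewrite -[ltRHS]mulrACA -invfM expr_div_n -expr2 ltr_pM2r ?invr_gt0 ?exprn_gt0 //.
have := mulr_gt0 d0 a_gt0; have := mulr_gt0 d0 c_gt0.
have := mulr_gt0 d0 d0; have := bac; lra.
Qed.

Lemma rootmx_sqr : rootmx a b c *m rootmx a b c = symmx a b c.
Proof.
have r0 : r != 0 by rewrite gt_eqF // sqrttr_gt0.
rewrite symmx_sqr -/d -/r; congr symmx; apply: (mulIf (expf_neq0 2 r0)).
- transitivity ((a + d) ^+ 2 + b ^+ 2); first by field.
  by rewrite sqrttr_sqr; have := sqrtdet_sqr; lra.
- transitivity (b * (a + c + 2 * d)); first by field.
  by rewrite sqrttr_sqr.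
- transitivity ((c + d) ^+ 2 + b ^+ 2); first by field.
  by rewrite sqrttr_sqr; have := sqrtdet_sqr; lra.
Qed.

Lemma rootmx_comm (P : 'M[R[i]]_2) :
  comm_mx P (symmx a b c) -> comm_mx P (rootmx a b c).
Proof.
move=> cP.
have -> : rootmx a b c = ((r^-1)%:C)%:M *m (symmx a b c + (d%:C)%:M).
  rewrite mul_scalar_mx -symmx_scalar symmxD symmxZ addr0.
  by rewrite /rootmx -/d -/r; congr symmx; rewrite mulrC.
by do ?[apply: comm_mxM | apply: comm_mxD | exact: comm_mx_scalar].
Qed.

End Root.

Section Summand.
Variables k p s t : R.
Hypotheses (p_gt0 : 0 < p) (spt : s ^+ 2 < p * t).
(* The entries of Z^2 + 4 k^2 I for Z = [[p, s], [s, t]]. *)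
Let a := p ^+ 2 + s ^+ 2 + 4 * k ^+ 2.
Let b := s * (p + t).
Let c := s ^+ 2 + t ^+ 2 + 4 * k ^+ 2.

Lemma shifted_sqr_gt0 : 0 < a.
Proof.
rewrite /a -addrA ltr_pwDl ?exprn_gt0 //.
by rewrite addr_ge0 ?sqr_ge0 // mulr_ge0 ?sqr_ge0.
Qed.

Lemma shifted_sqr_det : b ^+ 2 < a * c.
Proof.
rewrite -subr_gt0.
have -> : a * c - b ^+ 2 = (p * t - s ^+ 2) ^+ 2 +
   4 * k ^+ 2 * (p ^+ 2 + s ^+ 2 + s ^+ 2 + t ^+ 2 + 4 * k ^+ 2).
  by rewrite /a /b /c; ring.
rewrite ltr_pwDl ?exprn_gt0 ?subr_gt0 //.
by do ![exact: sqr_ge0 | exact: ler0n | apply: addr_ge0 | apply: mulr_ge0].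
Qed.

(** The root of Z^2 + 4 k^2 I is a polynomial in Z^2 = P^4, so it commutes with
    P and [summand_scalar] applies. *)
Lemma summand_symmx :
  summand (symmx k 0 k) (symmx p s t) = 2^-1 *: (rootmx a b c - symmx p s t).
Proof.
rewrite symmx_scalar -(rootmx_sqr p_gt0 spt).
have eS : rootmx a b c *m rootmx a b c =
    symmx p s t *m symmx p s t + (4 * (k%:C) ^+ 2)%:M.
  rewrite rootmx_sqr ?shifted_sqr_gt0 ?shifted_sqr_det // symmx_sqr.
  have -> : 4 * k%:C ^+ 2 = (4 * k ^+ 2)%:C by rewrite rmorphM rmorphXn rmorph_nat.
  by rewrite -symmx_scalar symmxD addr0.
apply: summand_scalar.
- exact: rootmx_posdef.
- by apply: rootmx_posdef; rewrite ?shifted_sqr_gt0 ?shifted_sqr_det.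
- apply: rootmx_comm; rewrite -rootmx_sqr ?shifted_sqr_gt0 ?shifted_sqr_det //.
  rewrite eS -(rootmx_sqr p_gt0 spt).
  by do ?[apply: comm_mxM | apply: comm_mxD | exact: comm_mx_scalar].
- by rewrite eS -(rootmx_sqr p_gt0 spt).
Qed.

End Summand.

End RealSymmetric2.

(** * The failure of convexity *)

Section Witness.
Variable R : realType.

Definition witness (i : 'I_2) : 'M[R[i]]_2 :=
  if i == ord0 then symmx 40 0 1 else symmx 2 0 2.

Definition line (t : R) : 'M[R[i]]_2 := symmx 2 1 t.

Lemma Ffun_line (t d r : R) : 1 / 2 < t ->
    d = Num.sqrt (21 * (17 + t ^+ 2) - (2 + t) ^+ 2) ->
    r = Num.sqrt (38 + t ^+ 2 + 2 * d) ->
  Ffun witness (line t) =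
  lambda_max (symmx ((2 + (21 + d) / r) / 2 + 40)
                    ((1 + (2 + t) / r) / 2)
                    ((t + (17 + t ^+ 2 + d) / r) / 2 + 1)).
Proof.
move=> t2 dE rE.
rewrite /Ffun big_ord_recl big_ord0 addr0 /line.
have t1 : 1 ^+ 2 < 2 * t by lra.
have p2 : 0 < 2 :> R by lra.
have -> : witness (lift ord0 ord0) = symmx 2 0 2 by [].
have -> : witness ord0 = symmx 40 0 1 by [].
rewrite (summand_symmx 2 p2 t1).
have -> : (2^-1 : R[i]) = (2^-1)%:C by rewrite fmorphV rmorph_nat.
have -> : symmx 2 1 t = 1%:C *: symmx 2 1 t by rewrite scale1r.
rewrite /rootmx -scaleNr -rmorphN !symmxZ !symmxD symmxZ !symmxD.
congr (lambda_max _).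
have aE : 2 ^+ 2 + 1 ^+ 2 + 4 * 2 ^+ 2 = 21 :> R by ring.
have bE : 1 * (2 + t) = 2 + t by rewrite mul1r.
have cE : 1 ^+ 2 + t ^+ 2 + 4 * 2 ^+ 2 = 17 + t ^+ 2 :> R by ring.
rewrite aE bE cE.
have -> : sqrttr 21 (2 + t) (17 + t ^+ 2) = r.
  by rewrite /sqrttr /sqrtdet -dE rE; congr (Num.sqrt _); ring.
have -> : sqrtdet 21 (2 + t) (17 + t ^+ 2) = d by rewrite /sqrtdet -dE.
by congr symmx; lra.
Qed.

Lemma sqrt_le (x y : R) : 0 <= y -> x <= y ^+ 2 -> Num.sqrt x <= y.
Proof. by move=> y0 xy; rewrite -[leRHS]ger0_norm // -sqrtr_sqr ler_wsqrtr. Qed.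

Lemma sqrt_ge (x y : R) : y ^+ 2 <= x -> y <= Num.sqrt x.
Proof. by move=> yx; apply: le_trans (ler_norm y) _; rewrite -sqrtr_sqr ler_wsqrtr. Qed.

(* The numerical bounds leave a margin of about 10^-5 in the top-left entry,
   which is what the gap of 10^-4 between the two sides of the convexity
   inequality allows. Decimals are split into groups of three digits because a
   numeral n of R is the n-fold sum of 1. *)

Lemma Ffun_line1 : Ffun witness (line 1) <= 43 + 296 / 10 ^+ 3 + 3 / 10 ^+ 4.
Proof.
rewrite (@Ffun_line _ _ _ _ erefl erefl); last lra.
set d := Num.sqrt (_ - _); set r := Num.sqrt (_ + _ * d).
have dl : 19 + 209 / 10 ^+ 3 + 37 / 10 ^+ 5 <= d by apply: sqrt_ge; lra.
have du : d <= 19 + 209 / 10 ^+ 3 + 38 / 10 ^+ 5 by apply: sqrt_le; lra.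
have rl : 8 + 798 / 10 ^+ 3 + 75 / 10 ^+ 5 <= r by apply: sqrt_ge; lra.
have r0 : 0 < r by lra.
have S11 : (21 + d) / r <= 4 + 569 / 10 ^+ 3 + 9 / 10 ^+ 4.
  by rewrite ler_pdivrMr //; lra.
have S12l : 0 <= (2 + 1) / r by apply: divr_ge0; lra.
have S12 : (2 + 1) / r <= 341 / 10 ^+ 3 + 2 / 10 ^+ 4 by rewrite ler_pdivrMr //; lra.
have S22 : (17 + 1 ^+ 2 + d) / r <= 424 / 100 by rewrite ler_pdivrMr //; lra.
apply: lambda_max_symmx_le; [lra|lra|nra].
Qed.

Lemma Ffun_line3 : Ffun witness (line 3) <= 43 + 291 / 10 ^+ 3 + 65 / 10 ^+ 5.
Proof.
rewrite (@Ffun_line _ _ _ _ erefl erefl); last lra.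
set d := Num.sqrt (_ - _); set r := Num.sqrt (_ + _ * d).
have dl : 22 + 825 / 10 ^+ 3 + 42 / 10 ^+ 5 <= d by apply: sqrt_ge; lra.
have du : d <= 22 + 825 / 10 ^+ 3 + 43 / 10 ^+ 5 by apply: sqrt_le; lra.
have rl : 9 + 625 / 10 ^+ 3 + 5 / 10 ^+ 4 <= r by apply: sqrt_ge; lra.
have r0 : 0 < r by lra.
have S11 : (21 + d) / r <= 4 + 553 / 10 ^+ 3 + 8 / 10 ^+ 5.
  by rewrite ler_pdivrMr //; lra.
have S12l : 0 <= (2 + 3) / r by apply: divr_ge0; lra.
have S12 : (2 + 3) / r <= 52 / 100 by rewrite ler_pdivrMr //; lra.
have S22 : (17 + 3 ^+ 2 + d) / r <= 508 / 100 by rewrite ler_pdivrMr //; lra.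
apply: lambda_max_symmx_le; [lra|lra|nra].
Qed.

Lemma Ffun_line2 : 43 + 294 / 10 ^+ 3 <= Ffun witness (line 2).
Proof.
rewrite (@Ffun_line _ _ _ _ erefl erefl); last lra.
set d := Num.sqrt (_ - _); set r := Num.sqrt (_ + _ * d).
have dl : 20 + 615 / 10 ^+ 3 + 5 / 10 ^+ 4 <= d by apply: sqrt_ge; lra.
have du : d <= 20 + 615 / 10 ^+ 3 + 53 / 10 ^+ 5 by apply: sqrt_le; lra.
have rl : 9 <= r by apply: sqrt_ge; lra.
have ru : r <= 9 + 123 / 10 ^+ 3 + 11 / 10 ^+ 5 by apply: sqrt_le; lra.
have r0 : 0 < r by lra.
have S11 : 4 + 561 / 10 ^+ 3 + 52 / 10 ^+ 5 <= (21 + d) / r.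
  by rewrite ler_pdivlMr //; lra.
have S12 : 438 / 1000 <= (2 + 2) / r by rewrite ler_pdivlMr //; lra.
have -> : 17 + 2 ^+ 2 = 21 :> R by ring.
have S22 : (21 + d) / r <= 5 by rewrite ler_pdivrMr //; lra.
apply: lambda_max_symmx_ge; nra.
Qed.

End Witness.

Theorem theorem1p14 (R : realType) :
  exists (d n : nat) (A : 'I_n.+1 -> 'M[R[i]]_d),
    [/\ (1 <= d)%N, (1 <= n)%N,
        (forall i, A i \is hermsymmx),
        (forall i, posdefmx (A i))
      & ~ convex_on [set Z | posdefmx Z] (Ffun A)].
Proof.
have mid : (2^-1)%:C *: line 1 + (1 - 2^-1)%:C *: line 3 = line (2 : R).
  by rewrite /line !symmxZ symmxD; congr symmx; lra.
have arith (f1 f2 f3 : R) : f1 <= 43 + 296 / 10 ^+ 3 + 3 / 10 ^+ 4 ->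
    43 + 294 / 10 ^+ 3 <= f2 -> f3 <= 43 + 291 / 10 ^+ 3 + 65 / 10 ^+ 5 ->
    f2 <= 2^-1 * f1 + (1 - 2^-1) * f3 -> False by lra.
have pA i : posdefmx (@witness R i).
  by rewrite /witness; case: ifP => _; apply: posdefmx_symmx; lra.
have pZ (t : R) : 1 / 2 < t -> posdefmx (line t).
  by move=> t2; apply: posdefmx_symmx; lra.
exists 2%N, 1%N, (@witness R); split=> // [i|cvx]; first exact: (pA i).1.
have half : 0 <= (2^-1 : R) <= 1 by lra.
have p1 : posdefmx (line (1 : R)) by apply: pZ; lra.
have p3 : posdefmx (line (3 : R)) by apply: pZ; lra.
have F := cvx _ _ p1 p3 _ half.
rewrite mid in F.
exact: arith (Ffun_line1 R) (Ffun_line2 R) (Ffun_line3 R) F.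
Qed.
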